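(* Let $T>0$, $\mathcal I=[0,T]$, and let $C:\mathcal I\rightrightarrows\mathbb R^d$ be an admissible set-valued map varying in an absolutely continuous way. Let $l\in C^0(\mathcal I,\mathbb R^d)$ with $l(0)=u_0\in C(0)$. For a time step $h>0$ put $t_h^n=nh$ (a partition of $\mathcal I$, $1\le n\le T/h$) and define the discretized solution $$\tilde x_h(t)=u_0\ \text{ for } t\in[0,t_h^1],\qquad \tilde x_h(t)=P_{C(t_h^{n+1})}\big[\tilde x_h(t_h^n)+l(t)-l(t_h^n)\big]\ \text{ for } t\in\,]t_h^n,t_h^{n+1}] .$$ Then, as $h\to0$, $\tilde x_h$ converges strongly in $L^\infty(\mathcal I)$ to $x$, where $(x,k)$ is the unique solution of the Skorohod problem associated with $l$, i.e. $x(t)+k(t)=l(t)$ for $t\in\mathcal I$, $x(0)=u_0$.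
   Context: $|\cdot|$ is the Euclidean norm on $\mathbb R^d$. All set-valued maps $C$ have nonempty closed values. For a closed set $S\subset\mathbb R^d$, $d_S(x)=\inf_{y\in S}|y-x|$, $P_S(x)=\{y\in S: |x-y|=d_S(x)\}$ (identified with its element when it is a singleton; for the scheme this is the case for $h$ small enough), and for $x\in S$ the proximal normal cone is $\mathrm N(S,x)=\{v\in\mathbb R^d:\exists s>0,\ x\in P_S(x+sv)\}$. For $\eta>0$, $S$ is $\eta$-prox-regular if $B(x+\eta\frac{v}{|v|},\eta)\cap S=\emptyset$ (open ball) for all $x\in S$ and $v\in \mathrm N(S,x)\setminus\{0\}$. Hausdorff distance: $d_H(S_1,S_2)=\sup_{y\in\mathbb R^d}|d_{S_1}(y)-d_{S_2}(y)|$. Admissible: $C$ is admissible on $[0,T]$ if there is $\eta>0$ such that every $C(t)$ is $\eta$-prox-regular, and there exist $\delta,r,\tau>0$ and, for every $t\in[0,T]$, sequences $(x_p)_p$ in $C(t)$ and $(u_p)_p$ of unit vectors such that for all $s\in[0,T]$ with $|t-s|\le\tau$, the balls $(B(x_p,r))_p$ form a bounded covering of $\partial C(s)$ (a covering with bounded overlap: there is $N$ such that each point lies in at most $N$ of the balls), and for all $p$, all $y\in\partial C(s)\cap B(x_p,2r)$ and all $v\in \mathrm N(C(s),y)$ one has $\langle v,u_p\rangle\ge\delta|v|$. Varying in an absolutely continuous way: there is an absolutely continuous function $v:\mathcal I\to\mathbb R$ with $d_H(C(t),C(s))\le|v(t)-v(s)|$ for all $s,t\in\mathcal I$. Skorohod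 problem for a continuous $l:\mathcal I\to\mathbb R^d$ with $l(0)\in C(0)$: a pair $(x,k)$ of continuous functions $\mathcal I\to\mathbb R^d$ is a solution if $x(t)\in C(t)$ for all $t$; $k$ has bounded variation on $\mathcal I$; writing $|k|(t)$ for the total variation of $k$ on $[0,t]$, $|k|(t)=\int_0^t\mathbf 1_{x(s)\in\partial C(s)}d|k|(s)$ and $k(t)=\int_0^t\xi(s)d|k|(s)$ with $\xi(s)\in \mathrm N(C(s),x(s))$; and $x(t)+k(t)=l(t)$ for all $t\in\mathcal I$. Under the present hypotheses this problem has a unique solution. *)

(* Defs.v *)
(* The library norm on 'rV[R]_d is the sup norm, so the Euclidean norm is defined
   separately, while topological notions (closed, interior, closure, continuity) are the
   library's, the two norms inducing the same topology. *)
From HB Require Import structures.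
From mathcomp Require Export all_boot all_order all_algebra.
From mathcomp Require Export all_classical all_reals all_analysis.
Export Order.TTheory GRing.Theory Num.Theory.
Export numFieldNormedType.Exports.

Set Implicit Arguments.
Unset Strict Implicit.
Unset Printing Implicit Defensive.

Local Open Scope classical_set_scope.
Local Open Scope card_scope.
Local Open Scope ring_scope.

Section Euclidean.
Context {R : realType} {d : nat}.
Implicit Types (S : set 'rV[R]_d) (u v x y : 'rV[R]_d).

Definition edot u v : R := \sum_i u ord0 i * v ord0 i.

Definition enorm v : R := Num.sqrt (edot v v).

Definition eball x (r : R) : set 'rV[R]_d := [set y | enorm (y - x) < r].

Definition edist_set S x : R := inf [set enorm (y - x) | y in S].

Definition proj_set S x : set 'rV[R]_d :=
  [set y | S y /\ enorm (x - y) = edist_set S x].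

Definition prox_normal S x : set 'rV[R]_d :=
  [set v | exists s : R, 0 < s /\ proj_set S (x + s *: v) x].

Definition prox_regular (eta : R) S : Prop :=
  forall x v, S x -> prox_normal S x v -> v != 0 ->
    eball (x + (eta / enorm v) *: v) eta `&` S = set0.

Definition boundary S : set 'rV[R]_d := closure S `\` interior S.

(* Extended-real valued: the supremum is infinite for, e.g., a bounded set
   against an unbounded one. *)
Definition hausdorff_dist S1 S2 : \bar R :=
  ereal_sup [set (`|edist_set S1 y - edist_set S2 y|)%:E | y in setT].

End Euclidean.

Section AbsolutelyContinuous.
Context {R : realType}.

Definition abs_continuous (a b : R) (f : R -> R) : Prop :=
  forall e : R, 0 < e -> exists2 del : R, 0 < del &
    forall (n : nat) (s t : 'I_n -> R),
      (forall i, a <= s i /\ s i <= t i /\ t i <= b) ->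
      trivIset setT (fun i => `]s i, t i[%classic) ->
      \sum_i (t i - s i) < del ->
      \sum_i `|f (t i) - f (s i)| < e.

End AbsolutelyContinuous.

Section MovingSets.
Context {R : realType} {d : nat}.
Implicit Types (T : R) (C : R -> set 'rV[R]_d).

(* The sequences (x_p), (u_p) are indexed by a subset J of nat, possibly finite
   or empty: for a bounded C(t), infinitely many balls of fixed radius centred
   in C(t) cannot have bounded overlap. *)
Definition admissible T C : Prop :=
  (exists2 eta : R, 0 < eta & forall t, t \in `[0, T] -> prox_regular eta (C t)) /\
  (exists delta r tau : R, [/\ 0 < delta, 0 < r, 0 < tau &
    forall t, t \in `[0, T] ->
    exists (J : set nat) (x u : nat -> 'rV[R]_d),
      [/\ forall p, J p -> C t (x p),
          forall p, J p -> enorm (u p) = 1,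
          exists N : nat, forall y,
            [set p | J p /\ eball (x p) r y] #<= `I_N &
          forall s, s \in `[0, T] -> `|t - s| <= tau ->
            boundary (C s) `<=` \bigcup_(p in J) eball (x p) r /\
            forall p, J p ->
            forall y, boundary (C s) y -> eball (x p) (2 * r) y ->
            forall v, prox_normal (C s) y v ->
              delta * enorm v <= edot v (u p)]]).

Definition abs_continuously_varying T C : Prop :=
  exists2 v : R -> R, abs_continuous 0 T v &
    forall s t, s \in `[0, T] -> t \in `[0, T] ->
      (hausdorff_dist (C t) (C s) <= (`|v t - v s|)%:E)%E.

End MovingSets.

Section Skorohod.
Context {R : realType} {d : nat}.
Implicit Types (T : R) (C : R -> set 'rV[R]_d) (l x k : R -> 'rV[R]_d).

(* Same as the library's variation / total_variation, with the Euclidean norm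
   in place of the absolute value of real-valued functions. *)
Definition evariation (a b : R) k (s : seq R) : R :=
  let F n := k (nth b (a :: s) n) in
  \sum_(0 <= n < size s) enorm (F n.+1 - F n).

Definition evariations (a b : R) k : set R :=
  [set evariation a b k s | s in itv_partition a b].

Definition ebounded_variation (a b : R) k : Prop := has_ubound (evariations a b k).

Definition etotal_variation (a b : R) k : \bar R :=
  ereal_sup [set v%:E | v in evariations a b k].

(* V is the function |k|, extended from [0, T] to the real line by constants, so
   that lebesgue_stieltjes_measure V is the measure d|k|, without mass outside
   [0, T].  The integral of xi is taken coordinatewise. *)
Definition skorohod_solution T C l x k : Prop :=
  [/\ {within `[0, T], continuous x},
      {within `[0, T], continuous k},
      forall t, t \in `[0, T] -> C t (x t),
      ebounded_variation 0 T k /\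
      (exists (V : cumulative R R) (xi : R -> 'rV[R]_d),
        [/\ forall t, (V t)%:E = etotal_variation 0 (Num.min T (Num.max 0 t)) k,
            forall t, t \in `[0, T] ->
              ((V t)%:E = \int[lebesgue_stieltjes_measure V]_(s in `[0%R, t])
                 (\1_[set s' | boundary (C s') (x s')] s)%:E)%E,
            forall s, s \in `[0, T] -> prox_normal (C s) (x s) (xi s),
            forall i, (lebesgue_stieltjes_measure V).-integrable `[0, T]
                        (fun s => (xi s ord0 i)%:E) &
            forall t, t \in `[0, T] -> forall i,
              ((k t ord0 i)%:E = \int[lebesgue_stieltjes_measure V]_(s in `[0%R, t])
                 (xi s ord0 i)%:E)%E]) &
      forall t, t \in `[0, T] -> x t + k t = l t].

End Skorohod.

Section Scheme.
Context {R : realType} {d : nat}.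
Implicit Types (T h : R) (C : R -> set 'rV[R]_d) (l y : R -> 'rV[R]_d).

(* t_h^n = n h for n <= T / h; when h does not divide T, the last node T is
   added so that the nodes partition [0, T]. *)
Definition node T h (n : nat) : R := Num.min (n%:R * h) T.

(* y is a discretized solution with step h.  Membership in proj_set amounts to
   y t = P_C[...] as soon as the projection is a singleton. *)
Definition discretized T C l (u0 : 'rV[R]_d) h y : Prop :=
  (forall t, t \in `[0, node T h 1] -> y t = u0) /\
  (forall n t, (1 <= n)%N -> t \in `]node T h n, node T h n.+1] ->
     proj_set (C (node T h n.+1)) (y (node T h n) + l t - l (node T h n)) (y t)).

Definition Linfty_dist T x y : \bar R :=
  Lnorm (@lebesgue_measure R) +oo%E
    ((fun t => (enorm (x t - y t : 'rV[R]_d))%:E) \_ `[0, T]).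

End Scheme.

(* Main.v *)
(* The scheme is compared directly with the solution, with no compactness
   argument.  Proximal normals of an eta-prox-regular set satisfy
   <v, y - x> <= |v| |y - x|^2 / (2 eta), so along the nodes the squared error E
   obeys E' <= E + (2 / eta) (b + a) (E + kappa), where b is the length of the
   correction made by the projection, a is the mass of |xi| d|k| on the step and
   kappa tends to 0 with the moduli of continuity of C, l and x over a step.  By
   the discrete Gronwall lemma it is enough to bound the sum of the b uniformly in
   h.  On a time window so short that the iterates stay in one of the balls of the
   admissible covering, all corrections lie in a common cone, so the sum of their
   lengths is at most a constant times the length of their sum.  That the iterates
   do stay in the ball follows by bootstrap: if they have moved by at most 2 rho,
   hypomonotonicity and the cone condition bound the squared displacement by
   O(rho eps + rho^3), which is below rho^2 once rho, and then the moduli eps, are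
   small; the length of such a window does not depend on h. *)
Require Import Defs.
From mathcomp Require Import all_boot all_order all_algebra.
From mathcomp Require Import all_classical all_reals all_analysis.
From mathcomp Require Import ring lra ess_sup_inf.
Set Implicit Arguments.
Unset Strict Implicit.
Unset Printing Implicit Defensive.
Local Open Scope classical_set_scope.
Local Open Scope ring_scope.

(** * The Euclidean inner product and norm *)

Section EuclideanNorm.
Context {R : realType} {d : nat}.
Implicit Types (u v w x y : 'rV[R]_d) (a b c : R).

Lemma edotC u v : edot u v = edot v u.
Proof. by apply: eq_bigr => i _; rewrite mulrC. Qed.

Lemma edotDl u v w : edot (u + v) w = edot u w + edot v w.
Proof. by rewrite -big_split; apply: eq_bigr => i _; rewrite mxE mulrDl. Qed.

Lemma edotZl a u v : edot (a *: u) v = a * edot u v.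
Proof. by rewrite mulr_sumr; apply: eq_bigr => i _; rewrite mxE mulrA. Qed.

Lemma edotNl u v : edot (- u) v = - edot u v.
Proof. by rewrite -scaleN1r edotZl mulN1r. Qed.

Lemma edotBl u v w : edot (u - v) w = edot u w - edot v w.
Proof. by rewrite edotDl edotNl. Qed.

Lemma edotDr u v w : edot w (u + v) = edot w u + edot w v.
Proof. by rewrite edotC edotDl !(edotC w). Qed.

Lemma edotZr a u v : edot v (a *: u) = a * edot v u.
Proof. by rewrite edotC edotZl edotC. Qed.

Lemma edotNr u v : edot v (- u) = - edot v u.
Proof. by rewrite edotC edotNl edotC. Qed.

Lemma edotBr u v w : edot w (u - v) = edot w u - edot w v.
Proof. by rewrite edotDr edotNr. Qed.

Lemma edot0l v : edot 0 v = 0.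
Proof. by rewrite -(scale0r 0) edotZl mul0r. Qed.

Lemma edot0r v : edot v 0 = 0.
Proof. by rewrite edotC edot0l. Qed.

Lemma edot_suml (I : Type) (r : seq I) (P : pred I) (F : I -> 'rV[R]_d) v :
  edot (\sum_(i <- r | P i) F i) v = \sum_(i <- r | P i) edot (F i) v.
Proof.
by apply: (big_morph (edot^~ v)) => [u w|]; rewrite ?edotDl ?edot0l.
Qed.

Lemma edot_ge0 v : 0 <= edot v v.
Proof. by apply: sumr_ge0 => i _; rewrite -expr2 sqr_ge0. Qed.

Lemma edot_eq0 v : edot v v = 0 -> v = 0.
Proof.
move=> /eqP; rewrite psumr_eq0 => [/allP v0|i _]; last by rewrite -expr2 sqr_ge0.
apply/rowP => i; rewrite mxE; apply/eqP.
by have := v0 i (mem_index_enum i); rewrite mulf_eq0 orbb.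
Qed.

Lemma enorm_ge0 v : 0 <= enorm v.
Proof. exact: sqrtr_ge0. Qed.

Lemma sqr_enorm v : enorm v ^+ 2 = edot v v.
Proof. by rewrite sqr_sqrtr// edot_ge0. Qed.

Lemma enorm0 : enorm (0 : 'rV[R]_d) = 0.
Proof. by rewrite /enorm edot0l sqrtr0. Qed.

Lemma enorm_eq0 v : enorm v = 0 -> v = 0.
Proof. by move=> v0; apply: edot_eq0; rewrite -sqr_enorm v0 expr0n. Qed.

Lemma enorm_gt0 v : v != 0 -> 0 < enorm v.
Proof.
move=> v0; rewrite lt_neqAle enorm_ge0 andbT eq_sym.
by apply: contra v0 => /eqP/enorm_eq0 ->.
Qed.

Lemma enormN v : enorm (- v) = enorm v.
Proof. by rewrite /enorm edotNl edotNr opprK. Qed.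

Lemma enormB u v : enorm (u - v) = enorm (v - u).
Proof. by rewrite -enormN opprB. Qed.

Lemma enormZ a v : enorm (a *: v) = `|a| * enorm v.
Proof.
by rewrite /enorm edotZl edotZr mulrA -expr2 sqrtrM ?sqr_ge0// sqrtr_sqr.
Qed.

Lemma sqr_enormB u v :
  enorm (u - v) ^+ 2 = enorm u ^+ 2 - 2 * edot u v + enorm v ^+ 2.
Proof. rewrite !sqr_enorm edotBl !edotBr (edotC v u); ring. Qed.

(** Cauchy-Schwarz, from expanding the nonnegative squared norm of [enorm v *: u - enorm u *: v]. *)
Lemma edot_le u v : edot u v <= enorm u * enorm v.
Proof.
have [->|v0] := eqVneq v 0; first by rewrite edot0r enorm0 mulr0.
have N0 := enorm_gt0 v0; rewrite -(ler_pM2r N0).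
have := edot_ge0 (enorm v *: u - enorm u *: v).
rewrite edotBl !edotBr !edotZl !edotZr (edotC v u) -!sqr_enorm => H.
have [u0|u0] := eqVneq (enorm u) 0.
  by rewrite (enorm_eq0 u0) edot0l enorm0 !mul0r.
have {}u0 : 0 < enorm u by rewrite lt_neqAle eq_sym u0 enorm_ge0.
rewrite -(ler_pM2l u0); nra.
Qed.

Lemma enormD u v : enorm (u + v) <= enorm u + enorm v.
Proof.
rewrite -(@ler_pXn2r _ 2) ?nnegrE ?addr_ge0 ?enorm_ge0//.
rewrite sqr_enorm edotDl !edotDr (edotC v u) -!sqr_enorm.
have := edot_le u v; lra.
Qed.

Lemma enormD3 u v w : enorm (u - w) <= enorm (u - v) + enorm (v - w).
Proof. by rewrite -[u - w](subrKA v) enormD. Qed.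

Lemma enorm_le_l1 v : enorm v <= \sum_i `|v ord0 i|.
Proof.
have S0 : 0 <= \sum_i `|v ord0 i| by apply: sumr_ge0 => i _.
rewrite -(@ler_pXn2r _ 2) ?nnegrE ?enorm_ge0// sqr_enorm expr2 mulr_suml.
apply: ler_sum => i _; apply: (le_trans (ler_norm _)); rewrite normrM.
rewrite ler_wpM2l// (bigD1 i)//= lerDl.
by apply: sumr_ge0 => j _.
Qed.

Lemma enorm_le_norm v : enorm v <= d%:R * `|v|.
Proof.
apply: (le_trans (enorm_le_l1 v)).
rewrite -[X in X%:R * _]card_ord mulr_natl -sumr_const; apply: ler_sum => i _.
rewrite /Num.norm/= mx_normrE.
exact: (le_trans _ (le_bigmax _ (fun j => `|v j.1 j.2|) (ord0, i))).
Qed.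

End EuclideanNorm.

(** * Uniform continuity on a compact interval *)

Section UniformContinuity.
Context {R : realType} {d : nat}.

Lemma unif_continuous_itv (a b : R) (f : R -> 'rV[R]_d) :
  {within `[a, b], continuous f} -> forall e : R, 0 < e ->
  exists2 th : R, 0 < th & forall s t, s \in `[a, b] -> t \in `[a, b] ->
    `|t - s| <= th -> enorm (f t - f s) <= e.
Proof.
move=> /subspace_continuousP cf e e0.
(* The comparison factor between the sup norm and the Euclidean norm is [d + 1] rather than [d], so
   as to be invertible in dimension 0. *)
have d0 : 0 < d%:R + 1 :> R by rewrite ltr_pwDr.
pose P (th s : R) := s \in `[a, b] -> forall t, t \in `[a, b] -> `|t - s| <= th ->
  enorm (f t - f s) <= e.
(* Compactness in near-covering form: if around each point [P th s] holds for nearby [s] and all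
   small [th > 0], then small [th] serve the whole segment at once. *)
have := @segment_compact R a b; rewrite compact_near_coveringP.
move=> /(_ _ (0^'+) P)/= [].
  move=> x xab; have /cvgrPdist_le/= /(_ (e / 2 / (d%:R + 1))) := cf x xab.
  rewrite !divr_gt0// => /(_ isT); rewrite /prop_near1 /within/=.
  move=> /nbhs_ballP[r/= r0 rP].
  exists (ball x (r / 2), [set th | th < r / 2]) => /=.
    split; first by apply: nbhsx_ballx; rewrite divr_gt0.
    by apply: nbhs_right_lt; rewrite divr_gt0.
  move=> [s th]/= [xs th_r] sab t tab ts.
  have fx u : u \in `[a, b] -> `|x - u| < r -> enorm (f x - f u) <= e / 2.
    move=> uab xu; have := rP u xu uab => fxu.
    apply: (le_trans (enorm_le_norm _)).
    apply: (@le_trans _ _ ((d%:R + 1) * `|f x - f u|)).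
      by rewrite ler_wpM2r// lerDl.
    by move: fxu; rewrite ler_pdivlMr// mulrC.
  move: xs; rewrite /ball/= => xs.
  have xt : `|x - t| < r.
    by have := ler_distD s x t; rewrite (distrC s t); lra.
  have xs' : `|x - s| < r by lra.
  have := enormD3 (f t) (f x) (f s); rewrite (enormB (f t) (f x)).
  by have := fx t tab xt; have := fx s sab xs'; lra.
move=> e1 /= e10 covP; exists (e1 / 2); first by rewrite divr_gt0.
move=> s t sab; apply: (covP (e1 / 2)) => //; last by rewrite divr_gt0.
by rewrite /ball_/= sub0r normrN gtr0_norm ?divr_gt0//; lra.
Qed.

End UniformContinuity.

(** * Projections, proximal normals and the prox-regularity inequality *)

Section ProximalNormals.
Context {R : realType} {d : nat}.
Implicit Types (S : set 'rV[R]_d) (p q v w x y z : 'rV[R]_d).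

Lemma edist_set_le S x y : S y -> edist_set S x <= enorm (y - x).
Proof.
move=> Sy; apply: ge_inf; last by exists y.
by exists 0 => _ [z _ <-]; exact: enorm_ge0.
Qed.

Lemma edist_set_ge0 S x : 0 <= edist_set S x.
Proof.
have [[y Sy]|S0] := pselect (S !=set0).
  apply: lb_le_inf; first by exists (enorm (y - x)), y.
  by move=> _ [z _ <-]; exact: enorm_ge0.
(* For empty [S] the infimum takes its default value 0. *)
rewrite /edist_set; suff -> : [set enorm (y - x) | y in S] = set0 by rewrite inf0.
by rewrite -subset0 => t [y Sy _]; apply: S0; exists y.
Qed.

Lemma edist_set_self S x : S x -> edist_set S x = 0.
Proof.
move=> Sx; apply/eqP; rewrite eq_le edist_set_ge0 andbT.
by rewrite (le_trans (edist_set_le x Sx))// subrr enorm0.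
Qed.

Lemma proj_set_le S w y z : proj_set S w y -> S z ->
  enorm (w - y) <= enorm (w - z).
Proof. by move=> [_ ->] Sz; rewrite (enormB w) edist_set_le. Qed.

Lemma proj_set_normal S w y : proj_set S w y -> prox_normal S y (w - y).
Proof. by move=> wy; exists 1; split=> //; rewrite scale1r addrC subrK. Qed.

(** As [y] lies outside the open ball of radius [eta] touching [S] at [x] in the direction [v], its
    squared distance to the centre is at least [eta ^+ 2]; when this square is expanded, the terms
    [eta ^+ 2] cancel. *)
Lemma prox_regular_le eta S x y v : 0 < eta -> prox_regular eta S ->
  S x -> S y -> prox_normal S x v ->
  edot v (y - x) <= enorm v * enorm (y - x) ^+ 2 / (2 * eta).
Proof.
move=> eta0 regS Sx Sy nv.
have [->|v0] := eqVneq v 0; first by rewrite edot0l enorm0 !mul0r.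
have N0 := enorm_gt0 v0.
have : ~ eball (x + (eta / enorm v) *: v) eta y.
  by move=> yb; have : (eball (x + (eta / enorm v) *: v) eta `&` S) y by [];
     rewrite regS.
move/negP; rewrite -leNgt opprD addrA => Hy.
have : eta ^+ 2 <= enorm (y - x - (eta / enorm v) *: v) ^+ 2.
  by rewrite ler_pXn2r ?nnegrE ?enorm_ge0 ?(ltW eta0).
rewrite (sqr_enormB (y - x) ((eta / enorm v) *: v)) edotZr enormZ exprMn.
rewrite real_normK ?num_real// (edotC _ v).
set D := edot v (y - x); set N := enorm v in N0 *; set M := enorm (y - x) => H.
rewrite ler_pdivlMr ?mulr_gt0//.
have -> : D * (2 * eta) = N * (2 * (eta / N * D)) by field; rewrite gt_eqF.
have E : (eta / N) ^+ 2 * N ^+ 2 = eta ^+ 2 by field; rewrite gt_eqF.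
rewrite ler_pM2l//; move: H; rewrite E; lra.
Qed.

(** Were [x] interior, a short step from [x] along [v] would stay in [S] and come closer to
    [x + s *: v] than its projection [x]. *)
Lemma prox_normal_boundary S x v : S x -> prox_normal S x v -> v != 0 ->
  boundary S x.
Proof.
move=> Sx [s [s0 pv]] v0; split; first exact: subset_closure.
move=> /nbhs_interior/= /nbhs_singleton; rewrite /interior/= => nS.
have N0 := enorm_gt0 v0.
have cv : (x + e *: v) @[e --> (0 : R)] --> x + 0 *: v.
  by apply: cvgD; [exact: cvg_cst|apply: cvgZr_tmp; exact: cvg_id].
have : \forall e \near (0 : R), S (x + e *: v).
  by apply: cv; rewrite scale0r addr0.
move=> /nbhs_ballP[r/= r0 rS].
pose e := Num.min (r / 2) s.
have e0 : 0 < e by rewrite lt_min s0 divr_gt0.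
have Se : S (x + e *: v).
  apply: rS; rewrite /ball/= sub0r normrN gtr0_norm//.
  by rewrite gt_min; apply/orP; left; lra.
have := proj_set_le pv Se.
rewrite addrAC subrr add0r opprD addrACA subrr add0r -scalerBl !enormZ.
rewrite ler_pM2r// gtr0_norm// ger0_norm; last by rewrite subr_ge0 ge_min lexx orbT.
lra.
Qed.

End ProximalNormals.

(** * Moduli of continuity of the moving set *)

Section Modulus.
Context {R : realType} {d : nat}.

Lemma abs_continuous_unif (a b : R) (f : R -> R) : abs_continuous a b f ->
  forall e : R, 0 < e -> exists2 th : R, 0 < th & forall s t, s \in `[a, b] ->
    t \in `[a, b] -> `|t - s| <= th -> `|f t - f s| < e.
Proof.
move=> acf e e0; have [del del0 H] := acf e e0.
have ordered s t : s \in `[a, b] -> t \in `[a, b] -> s <= t ->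
    `|t - s| <= del / 2 -> `|f t - f s| < e.
  rewrite !in_itv/= => /andP[as_ _] /andP[_ tb] st tsd.
  have := H 1%N (fun=> s) (fun=> t); rewrite !big_ord1; apply => //.
    by move=> i j _ _; rewrite !ord1.
  by rewrite -(ger0_norm (_ : 0 <= t - s)) ?subr_ge0// (le_lt_trans tsd)//; lra.
exists (del / 2); first by rewrite divr_gt0.
move=> s t sab tab tsd; have [st|/ltW ts] := lerP s t; first exact: ordered.
by rewrite distrC; apply: ordered; rewrite // distrC.
Qed.

(** At the point [p] of [S2] the supremum bounds the distance from [p] to [S1] itself; the strict
    inequality then yields [q] straight from the infimum, a genuine one as [S1] is nonempty. *)
Lemma hausdorff_near (S1 S2 : set 'rV[R]_d) (e : R) p :
  S1 !=set0 -> (hausdorff_dist S1 S2 < e%:E)%E -> S2 p ->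
  exists2 q, S1 q & enorm (q - p) < e.
Proof.
move=> [q0 Sq0] He Sp.
have : edist_set S1 p < e.
  rewrite -[ltLHS]subr0 -(edist_set_self Sp) (le_lt_trans (ler_norm _))//.
  rewrite -lte_fin (le_lt_trans _ He)//; apply: ereal_sup_ubound.
  by exists p.
move=> /inf_lt[]; first by exists (enorm (q0 - p)), q0.
by move=> _ [q Sq <-] qe; exists q.
Qed.

Lemma varying_near (T : R) (C : R -> set 'rV[R]_d) :
  (forall t, t \in `[0, T] -> C t !=set0) -> abs_continuously_varying T C ->
  forall e : R, 0 < e -> exists2 th : R, 0 < th & forall s t, s \in `[0, T] ->
    t \in `[0, T] -> `|t - s| <= th ->
    forall p, C s p -> exists2 q, C t q & enorm (q - p) <= e.
Proof.
move=> C0 [v acv dC] e e0; have [th th0 H] := abs_continuous_unif acv e0.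
exists th => // s t sT tT st p Csp.
have [|q Ctq qp] := hausdorff_near (e := e) (C0 t tT) _ Csp.
  by apply: (le_lt_trans (dC s t sT tT)); rewrite lte_fin H.
by exists q => //; exact: ltW.
Qed.

End Modulus.

(** * Integrals against a Stieltjes measure *)

Section StieltjesDensity.
Context {R : realType}.

Lemma Rintegral_sum (dd : measure_display) (X : measurableType dd)
    (mu : {measure set X -> \bar R}) (D : set X) (I : Type) (r : seq I)
    (f : I -> X -> R) :
  measurable D -> (forall i, mu.-integrable D (EFin \o f i)) ->
  mu.-integrable D (EFin \o (fun s => \sum_(i <- r) f i s)) /\
  \int[mu]_(s in D) (\sum_(i <- r) f i s) =
    \sum_(i <- r) \int[mu]_(s in D) f i s.
Proof.
move=> mD fi.
have sumi r' : mu.-integrable D (EFin \o (fun s => \sum_(i <- r') f i s)).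
  apply: (@eq_integrable _ _ _ _ _ mD (fun s => \sum_(i <- r') (f i s)%:E)%E).
    by move=> s _; rewrite /= sumEFin.
  by apply: integrable_sum => // i _; exact: fi.
split=> //; elim: r => [|i r IH].
  rewrite big_nil; under eq_Rintegral do rewrite big_nil.
  by rewrite /Rintegral integral0.
rewrite big_cons -IH -RintegralD//.
by under eq_Rintegral do rewrite big_cons.
Qed.

(** The point [a] lies in []b, a]], whose mass is [V a - V b]. *)
Lemma lebesgue_stieltjes_set1 (V : cumulative R R) (a b : R) :
  b < a -> V b = V a -> lebesgue_stieltjes_measure V [set a] = 0%E.
Proof.
move=> ba Vab; apply/eqP; rewrite eq_le measure_ge0 andbT.
have <- : lebesgue_stieltjes_measure V `]b, a] = 0%E.
  rewrite /lebesgue_stieltjes_measure /measure_extension/=.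
  rewrite measurable_mu_extE/=; last exact: is_ocitv.
  by rewrite wlength_itv_bnd ?(ltW ba)// Vab subrr.
by apply: le_measure; rewrite ?inE//= => _ ->; rewrite /= in_itv/= ba lexx.
Qed.

End StieltjesDensity.

(** * Increments of [k] as integrals of proximal normals *)

Section SkorohodDensity.
Context {R : realType} {d : nat}.

(** Trades the measure [d|k|] for a real function [M], so that a pointwise bound on the normals
    bounds the pairing of [w] with an increment of [k]: this pairing is the integral of
    [edot w (xi r)] over []s, t]]. *)
Lemma skorohod_density (T : R) (C : R -> set 'rV[R]_d) (l x k : R -> 'rV[R]_d) :
  0 < T -> skorohod_solution T C l x k ->
  k 0 = 0 /\
  exists (xi : R -> 'rV[R]_d) (M : R -> R),
    (forall s, s \in `[0, T] -> prox_normal (C s) (x s) (xi s)) /\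
    forall s t (w : 'rV[R]_d) c, 0 <= s -> s <= t -> t <= T -> 0 <= c ->
      (forall r, r \in `]s, t] -> edot w (xi r) <= c * enorm (xi r)) ->
      edot w (k t - k s) <= c * (M t - M s).
Proof.
move=> T0 [_ _ _ [_ [V [xi [VE _ nxi ixi kE]]]] _].
set mu := lebesgue_stieltjes_measure V in ixi kE *.
have mitv (i : interval R) : measurable ([set` i] : set (measurableTypeR R)).
  exact: measurable_itv.
split.
  (* [V] is constant to the left of 0, so the point 0 carries no mass. *)
  have mu0 : mu [set 0] = 0%E.
    apply: (@lebesgue_stieltjes_set1 _ _ _ (-1)); first by rewrite ltrN10.
    by apply: EFin_inj; rewrite !VE !max_l ?lerN10 ?max_r//.
  apply/rowP => i; rewrite mxE; apply: EFin_inj.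
  rewrite kE ?in_itv/= ?lexx ?(ltW T0)// set_itv1 null_set_integral//.
  by apply: measurable_fun_set1.
pose f i s := xi s ord0 i.
have fi (D : set (measurableTypeR R)) i : measurable D -> D `<=` `[0, T] ->
    mu.-integrable D (EFin \o f i).
  by move=> mD D0T; apply: integrableS (ixi i) => //; exact: mitv.
have afi (D : set (measurableTypeR R)) i : measurable D -> D `<=` `[0, T] ->
    mu.-integrable D (EFin \o (fun s => `|f i s|)).
  by move=> mD D0T; apply: integrable_norm; exact: fi.
(* The l1 norm of [xi] dominates the Euclidean one and is integrable as a finite sum of integrable
   functions. *)
exists xi, (fun t => \int[mu]_(s in `[0, t]) (\sum_i `|f i s|)).
split=> // s t w c s0 st tT c0 H.
have sub2 : `]s, t]%classic `<=` `[0, T]%classic.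
  move=> r /=; rewrite !in_itv/= => /andP[sr rt].
  by rewrite (le_trans rt)// (le_trans s0)// ltW.
have sub3 : `[0, t]%classic `<=` `[0, T]%classic.
  by move=> r /=; rewrite !in_itv/= => /andP[-> rt]; rewrite (le_trans rt).
have incr (g : R -> R) : mu.-integrable `[0, t] (EFin \o g) ->
    \int[mu]_(r in `[0, t]) g r - \int[mu]_(r in `[0, s]) g r =
    \int[mu]_(r in `]s, t]) g r.
  have -> : `[0, t]%classic = `[0, s]%classic `|` `]s, t]%classic.
    by apply: itv_bndbnd_setU; rewrite bnd_simp.
  move=> ig; rewrite Rintegral_setU//; first by rewrite addrC addKr.
  apply/disj_setPRL => r /=; rewrite !in_itv/= => /andP[sr _] /andP[_].
  by rewrite leNgt sr.
have kincr i : (k t - k s) ord0 i = \int[mu]_(r in `]s, t]) f i r.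
  rewrite -incr ?fi// !mxE /Rintegral -!kE// in_itv/=.
    by rewrite s0 (le_trans st).
  by rewrite (le_trans s0 st).
have fi' i : mu.-integrable `]s, t] (EFin \o f i) by exact: fi.
have wfi i : mu.-integrable `]s, t] (EFin \o (fun r => w ord0 i * f i r)).
  exact: (integrableZl (mitv _) (w ord0 i) (fi' i)).
have [iw sumw] := Rintegral_sum (index_enum 'I_d) (mitv `]s, t]) wfi.
have afi' (r0 : R) : r0 <= T -> forall i,
    mu.-integrable `[0, r0] (EFin \o (fun r => `|f i r|)).
  move=> r0T i; apply: afi => // r /=; rewrite !in_itv/= => /andP[-> rr0].
  exact: (le_trans rr0).
have [ia _] := Rintegral_sum (index_enum 'I_d) (mitv `[0, t]) (afi' t tT).
have ia' : mu.-integrable `]s, t] (EFin \o (fun r => \sum_i `|f i r|)).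
  apply: integrableS ia => // r /=; rewrite !in_itv/= => /andP[sr ->].
  by rewrite andbT (le_trans s0)// ltW.
rewrite incr// -RintegralZl// /edot.
under eq_bigr do rewrite kincr -RintegralZl//.
rewrite -sumw; apply: le_Rintegral => //; first exact: (integrableZl (mitv _) c ia').
move=> r rst; rewrite (le_trans (H r rst))// ler_wpM2l//.
exact: enorm_le_l1.
Qed.

End SkorohodDensity.

(** * Catching-up iterations on a short time window *)

Section CatchingUp.
Context {R : realType} {d : nat}.
Implicit Types (S : nat -> set 'rV[R]_d) (p g : nat -> 'rV[R]_d).

(** The point [q] competes in the projection, so the correction has length at most
    [enorm (p0 + w - q) <= 2 * eps]; [w] adds one more [eps]. *)
Lemma proj_step_le (S : set 'rV[R]_d) (p0 p1 w : 'rV[R]_d) (eps : R) :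
  proj_set S (p0 + w) p1 -> enorm w <= eps ->
  (exists2 q, S q & enorm (q - p0) <= eps) ->
  enorm (p1 - p0) <= 3 * eps.
Proof.
move=> prj weps [q Sq qp]; have := proj_set_le prj Sq.
have := enormD w (p0 - q); rewrite (enormB p0).
have -> : p1 - p0 = w - (p0 + w - p1) by apply/rowP => j; rewrite !mxE; ring.
rewrite addrA [w + p0]addrC.
by have := enormD w (- (p0 + w - p1)); rewrite enormN; lra.
Qed.

(* The displacement made by the i-th projection, opposed to the constraint: it is
   an outward proximal normal at [p i.+1]. *)
Definition reaction p g (i : nat) : 'rV[R]_d := p i + (g i.+1 - g i) - p i.+1.

Lemma sum_reaction p g n :
  \sum_(i < n) reaction p g i = (g n - g 0%N) - (p n - p 0%N).
Proof.
elim: n => [|n IH]; first by rewrite big_ord0 !subrr.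
rewrite big_ord_recr/= IH /reaction; apply/rowP => i; rewrite !mxE; ring.
Qed.

(* All reactions have a component at least [delta] times their length along the
   same direction [u], so no cancellation occurs in their sum. *)
Lemma sum_reaction_le p g n (delta eps rho : R) (u : 'rV[R]_d) :
  0 < delta -> enorm u <= 1 ->
  (forall i, (i < n)%N ->
     delta * enorm (reaction p g i) <= edot (reaction p g i) u) ->
  enorm (g n - g 0%N) <= eps -> enorm (p n - p 0%N) <= rho ->
  \sum_(i < n) enorm (reaction p g i) <= (eps + rho) / delta.
Proof.
move=> delta0 u1 cone gn pn; rewrite ler_pdivlMr// mulrC.
rewrite mulr_sumr; apply: (@le_trans _ _ (edot (\sum_(i < n) reaction p g i) u)).
  by rewrite edot_suml; apply: ler_sum => i _; exact: cone.
apply: (le_trans (edot_le _ _)).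
apply: (@le_trans _ _ (enorm (\sum_(i < n) reaction p g i))).
  by rewrite ler_piMr ?enorm_ge0.
rewrite sum_reaction.
by have := enormD (g n - g 0%N) (- (p n - p 0%N)); rewrite enormN; lra.
Qed.

(** Let [k1] be a partial sum ending with the reaction [z]. Adding [z] raises the squared norm by
    [2 * edot k1 z - enorm z ^+ 2]. Since [k1] is the sum of [g m.+1 - g 0], [p 0 - q] and
    [q - p m.+1] with [q] in the current set, the first two cost [eps * enorm z] each, and
    prox-regularity at [p m.+1] bounds the third. *)
Lemma sqr_sum_reaction_le S p g n (eta eps rho : R) :
  0 < eta ->
  (forall i, (i < n)%N -> prox_regular eta (S i.+1)) ->
  (forall i, (i < n)%N ->
     proj_set (S i.+1) (p i + (g i.+1 - g i)) (p i.+1)) ->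
  (forall i, (i <= n)%N -> enorm (g i - g 0%N) <= eps) ->
  (forall i, (i < n)%N -> exists2 q, S i.+1 q & enorm (q - p 0%N) <= eps) ->
  (forall i, (i <= n)%N -> enorm (p i - p 0%N) <= rho) ->
  enorm (\sum_(i < n) reaction p g i) ^+ 2 <=
    2 * (2 * eps + (rho + eps) ^+ 2 / (2 * eta)) *
    \sum_(i < n) enorm (reaction p g i).
Proof.
move=> eta0 reg prj geps near prho.
set K := 2 * eps + _.
suff H m : (m <= n)%N -> enorm (\sum_(i < m) reaction p g i) ^+ 2 <=
    2 * K * \sum_(i < m) enorm (reaction p g i) by exact: H.
elim: m => [|m IH] lt_mn; first by rewrite !big_ord0 enorm0 expr0n mulr0.
have {}IH := IH (ltnW lt_mn).
set k1 := \sum_(i < m.+1) reaction p g i.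
have Ek : \sum_(i < m) reaction p g i = k1 - reaction p g m.
  by rewrite /k1 big_ord_recr/= addrK.
rewrite [\sum_(i < m.+1) enorm _]big_ord_recr/=.
move: IH; rewrite Ek sqr_enormB.
have [q Sq qp] := near m lt_mn.
have Sp := (prj m lt_mn).1.
have := prox_regular_le eta0 (reg m lt_mn) Sp Sq (proj_set_normal (prj m lt_mn)).
rewrite -/(reaction p g m); set z := reaction p g m.
have z0 : 0 <= enorm z := enorm_ge0 z.
have dist : enorm (q - p m.+1) <= rho + eps.
  by have := enormD3 q (p 0%N) (p m.+1); rewrite (enormB (p 0%N));
     have := prho m.+1 lt_mn; lra.
have dist2 : enorm z * enorm (q - p m.+1) ^+ 2 / (2 * eta) <=
    enorm z * ((rho + eps) ^+ 2 / (2 * eta)).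
  rewrite mulrA ler_wpM2r ?invr_ge0 ?mulr_ge0 ?(ltW eta0)// ler_wpM2l//.
  by rewrite ler_pXn2r ?nnegrE ?enorm_ge0// (le_trans (enorm_ge0 _) dist).
move=> hyp IH.
have kz : edot k1 z = edot (g m.+1 - g 0%N) z + edot z (q - p m.+1) +
    edot z (p 0%N - q).
  rewrite /k1 sum_reaction (edotC z) (edotC z) -!edotDl; congr (edot _ z).
  by apply/rowP => j; rewrite !mxE; ring.
have gz : edot (g m.+1 - g 0%N) z <= eps * enorm z.
  apply: (le_trans (edot_le _ _)); rewrite ler_wpM2r//; exact: geps.
have pz : edot z (p 0%N - q) <= eps * enorm z.
  apply: (le_trans (edot_le _ _)); rewrite mulrC ler_wpM2r//.
  by rewrite enormB.
have : 0 <= enorm z ^+ 2 by rewrite sqr_ge0.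
rewrite mulrDr; rewrite kz in IH; rewrite /K in IH *; lra.
Qed.

Lemma catching_up_window S p g n (eta delta eps rho r : R) :
  0 < eta -> 0 < delta -> 0 < eps -> 0 < rho ->
  3 * eps <= rho -> 96 * eps <= rho * delta -> 216 * rho <= delta * eta ->
  5 * rho <= r ->
  (forall i, (i < n)%N -> prox_regular eta (S i.+1)) ->
  (forall i, (i < n)%N ->
     proj_set (S i.+1) (p i + (g i.+1 - g i)) (p i.+1)) ->
  (forall i, (i <= n)%N -> enorm (g i - g 0%N) <= eps) ->
  (forall i, (i < n)%N -> exists2 q, S i.+1 q & enorm (q - p 0%N) <= eps) ->
  (forall i, (i < n)%N -> enorm (p i.+1 - p i) <= 3 * eps) ->
  (forall i, (i < n)%N -> reaction p g i != 0 ->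
     exists2 u, enorm u <= 1 & forall j, (j < n)%N ->
       enorm (p j.+1 - p i.+1) < r -> reaction p g j != 0 ->
       delta * enorm (reaction p g j) <= edot (reaction p g j) u) ->
  (forall i, (i <= n)%N -> enorm (p i - p 0%N) <= rho) /\
  \sum_(i < n) enorm (reaction p g i) <= (eps + rho) / delta.
Proof.
move=> eta0 delta0 eps0 rho0 er edr re rr reg prj geps near step cone.
have conem m : (m <= n)%N ->
    (forall i, (i <= m)%N -> enorm (p i - p 0%N) <= 2 * rho) ->
    exists2 u, enorm u <= 1 & forall i, (i < m)%N ->
      delta * enorm (reaction p g i) <= edot (reaction p g i) u.
  move=> mn pm.
  (* Any nonzero reaction supplies the direction [u]: iterates within [2 * rho] of the start are at
     most [4 * rho < r] apart. If all reactions vanish, [u = 0] works. *)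
  have [[i [im zi]]|none] := pselect (exists i, (i < m)%N /\ reaction p g i != 0).
    have [u u1 Hu] := cone i (leq_trans im mn) zi; exists u => // j jm.
    have [->|zj] := eqVneq (reaction p g j) 0; first by rewrite enorm0 edot0l mulr0.
    apply: Hu => //; first exact: leq_trans jm mn.
    have := enormD3 (p j.+1) (p 0%N) (p i.+1); rewrite (enormB (p 0%N)).
    have := pm _ im; have := pm _ jm; lra.
  exists 0; first by rewrite enorm0.
  move=> i im; have [->|zi] := eqVneq (reaction p g i) 0.
    by rewrite enorm0 edot0l mulr0.
  by exfalso; apply: none; exists i.
have near_start m : (m <= n)%N ->
    forall i, (i <= m)%N -> enorm (p i - p 0%N) <= rho.
  elim: m => [|m IH] mn i.
    by rewrite leqn0 => /eqP ->; rewrite subrr enorm0 ltW.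
  rewrite leq_eqVlt => /predU1P[->|]; last by move=> im; exact: IH (ltnW mn) _ im.
  (* One step moves by at most [3 * eps <= rho], so the bound [rho] up to [m] gives the weaker bound
     [2 * rho] at [m.+1], to be improved. *)
  have pm j : (j <= m.+1)%N -> enorm (p j - p 0%N) <= 2 * rho.
    rewrite leq_eqVlt => /predU1P[->|jm].
      have := enormD3 (p m.+1) (p m) (p 0%N); have := step m mn.
      by have := IH (ltnW mn) m (leqnn m); lra.
    by have := IH (ltnW mn) j jm; lra.
  have [u u1 Hu] := conem _ mn pm.
  have sum_le := sum_reaction_le delta0 u1 Hu (geps _ mn) (pm _ (leqnn _)).
  have := @sqr_sum_reaction_le S p g m.+1 eta eps (2 * rho) eta0.
  move=> /(_ (fun i im => reg i (leq_trans im mn))).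
  move=> /(_ (fun i im => prj i (leq_trans im mn))).
  move=> /(_ (fun i im => geps i (leq_trans im mn))).
  move=> /(_ (fun i im => near i (leq_trans im mn))) /(_ pm).
  set s := \sum_(i < m.+1) enorm _ in sum_le *; set K := 2 * eps + _ => sq.
  have s0 : 0 <= s by apply: sumr_ge0 => j _; exact: enorm_ge0.
  have {}sum_le : s * delta <= 3 * rho by move: sum_le; rewrite ler_pdivlMr//; lra.
  (* Each of the two terms of [K] is at most [rho * delta / 48]. With [s <= 3 * rho / delta], the
     squared norm of the sum is at most [2 * K * s <= rho ^+ 2 / 4], and [eps + rho / 2 <= rho]
     closes the induction. *)
  have KE : K <= rho * delta / 24.
    have : (2 * rho + eps) ^+ 2 / (2 * eta) <= rho * delta / 48.
      rewrite ler_pdivrMr ?mulr_gt0//; nra.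
    rewrite /K; lra.
  have k_le : enorm (\sum_(i < m.+1) reaction p g i) <= rho / 2.
    rewrite -(@ler_pXn2r _ 2) ?nnegrE ?enorm_ge0 ?divr_ge0 ?(ltW rho0)//.
    nra.
  have -> : p m.+1 - p 0%N =
      (g m.+1 - g 0%N) - \sum_(i < m.+1) reaction p g i.
    by rewrite sum_reaction opprB addrCA subrr addr0.
  have := enormD (g m.+1 - g 0%N) (- \sum_(i < m.+1) reaction p g i).
  rewrite enormN; have := geps _ mn; lra.
have prho := near_start n (leqnn n); split=> //.
have [|u u1 Hu] := conem n (leqnn n); first by move=> i /prho; lra.
exact: (sum_reaction_le delta0 u1 Hu (geps _ (leqnn _)) (prho _ (leqnn _))).
Qed.

End CatchingUp.

(** * A bound on the total length of the reactions, uniform in the grid *)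

Section TotalVariation.
Context {R : realType} {d : nat}.

(* Greedy splitting: a window is closed only after it has lasted [th / 2], so that
   there are at most [2 / th * tt n + 1] of them. *)
Lemma sum_windows_le (b tt : nat -> R) (th D : R) :
  0 < th -> 0 <= D -> 0 <= tt 0%N ->
  (forall j, tt j <= tt j.+1) ->
  (forall j, tt j.+1 - tt j <= th / 2) ->
  (forall m n, (m <= n)%N -> tt n - tt m <= th -> \sum_(m <= j < n) b j <= D) ->
  forall n, \sum_(0 <= j < n) b j <= D * (2 / th) * tt n + D.
Proof.
move=> th0 D0 tt0 ttS step win n.
have ttm : {homo tt : m n / (m <= n)%N >-> m <= n}.
  by apply: homo_leq => // y x z; exact: le_trans.
have dpos : 0 <= D * (2 / th) by rewrite mulr_ge0// divr_ge0// ltW.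
(* [m] is the start of the window still open at [n]: the closed windows are paid for by the elapsed
   time [tt m], and the open one costs the last [D]. *)
suff [m [mn tmn sm]] : exists m, [/\ (m <= n)%N, tt n - tt m <= th &
    \sum_(0 <= j < m) b j <= D * (2 / th) * tt m].
  rewrite (big_cat_nat (leq0n m) mn)//= lerD//; last exact: win.
  by rewrite (le_trans sm)// ler_wpM2l// ttm.
elim: n => [|n [m [mn tmn sm]]].
  by exists 0%N; rewrite subrr big_geq// mulr_ge0// (ltW th0).
have [tSn|tSn] := lerP (tt n.+1 - tt m) th.
  by exists m; rewrite (leq_trans mn).
exists n; split => //; first by have := step n; lra.
rewrite (big_cat_nat (leq0n m) mn)//=.
have half : th / 2 <= tt n - tt m by have := step n; lra.
have : D <= D * (2 / th) * (tt n - tt m).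
  rewrite -mulrA ler_peMr//.
  rewrite mulrAC ler_pdivlMr//; lra.
have := win m n mn tmn; nra.
Qed.

(** [tt] dates the sets and [nu] the values of [l]. Two grids are kept because the scheme starts
    from [u0], known to lie in [C 0], but with the value of [l] at the first node. [B] and [th] are
    chosen before the grids. *)
Lemma catching_up_variation (T : R) (C : R -> set 'rV[R]_d) (l : R -> 'rV[R]_d) :
  0 < T -> (forall t, t \in `[0, T] -> C t !=set0) ->
  admissible T C -> abs_continuously_varying T C ->
  {within `[0, T], continuous l} ->
  exists B th : R, [/\ 0 < th, 0 <= B &
    forall (tt nu : nat -> R) (p : nat -> 'rV[R]_d),
      (forall j, tt j \in `[0, T]) -> (forall j, nu j \in `[0, T]) ->
      (forall j, tt j <= tt j.+1 <= tt j + th) ->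
      (forall i j, (i <= j)%N -> `|nu j - nu i| <= tt j - tt i) ->
      (forall j, C (tt j) (p j)) ->
      (forall j, proj_set (C (tt j.+1)) (p j + (l (nu j.+1) - l (nu j))) (p j.+1)) ->
      forall n, \sum_(0 <= j < n) enorm (reaction p (l \o nu) j) <= B].
Proof.
move=> T0 C0 [[eta eta0 reg] [delta [r [tau [delta0 r0 tau0 adm]]]]] ac cl.
pose rho := Num.min (r / 5) (delta * eta / 216).
have rho0 : 0 < rho by rewrite lt_min !divr_gt0// mulr_gt0.
have rr : 5 * rho <= r.
  by have : rho <= r / 5; [rewrite ge_min lexx|lra].
have re : 216 * rho <= delta * eta.
  by have : rho <= delta * eta / 216; [rewrite ge_min lexx orbT|lra].
pose eps := Num.min (rho / 3) (rho * delta / 96).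
have eps0 : 0 < eps by rewrite lt_min !divr_gt0// mulr_gt0.
have er : 3 * eps <= rho.
  by have : eps <= rho / 3; [rewrite ge_min lexx|lra].
have edr : 96 * eps <= rho * delta.
  by have : eps <= rho * delta / 96; [rewrite ge_min lexx orbT|lra].
have [th1 th10 near] := varying_near C0 ac eps0.
have [th2 th20 lun] := unif_continuous_itv cl eps0.
(* Over a time [th] the covering chosen at the start of a window stays valid, and [C] and [l] move
   by at most [eps]. Single steps will be limited to [th / 2] for the splitting into windows. *)
pose th := Num.min tau (Num.min th1 th2).
have th0 : 0 < th by rewrite !lt_min tau0 th10.
have [th_tau th_1 th_2] : [/\ th <= tau, th <= th1 & th <= th2].
  by rewrite !ge_min !lexx !orbT.
pose D := (eps + rho) / delta.
have D0 : 0 <= D by rewrite divr_ge0 ?addr_ge0 ?ltW.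
have K0 : 0 <= D * (2 / th) by rewrite mulr_ge0// divr_ge0// ltW.
exists (D * (2 / th) * T + D), (th / 2).
split; [by rewrite divr_gt0|by rewrite addr_ge0// mulr_ge0// ltW|].
move=> tt nu p ttT nuT step nutt Cp prj n.
have ttS j : tt j <= tt j.+1 by case/andP: (step j).
have ttm : {homo tt : m n / (m <= n)%N >-> m <= n}.
  by apply: homo_leq => // y x z; exact: le_trans.
have stp j : tt j.+1 - tt j <= th / 2 by rewrite lerBlDl; case/andP: (step j).
apply: (@le_trans _ _ (D * (2 / th) * tt n + D)); last first.
  rewrite lerD2r ler_wpM2l//.
  by have := ttT n; rewrite in_itv/= => /andP[].
apply: sum_windows_le => //; first by have := ttT 0%N; rewrite in_itv/= => /andP[].
move=> m {}n mn tmn.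
have win i : (i <= n - m)%N -> 0 <= tt (i + m)%N - tt m <= th.
  move=> im; rewrite subr_ge0 ttm ?leq_addl//= (le_trans _ tmn)// lerD2r ttm//.
  by rewrite addnC -leq_subRL.
rewrite -{1}[m]add0n big_addn big_mkord.
have redE i : reaction p (l \o nu) (i + m) =
    reaction (fun i => p (i + m)%N) (fun i => l (nu (i + m)%N)) i by [].
under eq_bigr do rewrite redE.
have [J [xp [u [Cx u1 _ cover]]]] := adm (tt m) (ttT m).
have near_l i j : (i <= j)%N -> tt j - tt i <= th ->
    enorm (l (nu j) - l (nu i)) <= eps.
  move=> ij tij; apply: lun => //.
  by rewrite (le_trans (nutt i j ij))// (le_trans tij).
have near_C i j : (i <= j)%N -> tt j - tt i <= th ->
    exists2 q, C (tt j) q & enorm (q - p i) <= eps.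
  move=> ij tij; apply: (near (tt i)) => //.
  by rewrite ger0_norm ?subr_ge0 ?ttm// (le_trans tij).
have th2h : th / 2 <= th by lra.
have lts i : tt i.+1 - tt i <= th by exact: le_trans (stp i) _.
have bound := @catching_up_window R d (fun i => C (tt (i + m)%N))
  (fun i => p (i + m)%N) (fun i => l (nu (i + m)%N)) (n - m)%N
  eta delta eps rho r eta0 delta0 eps0 rho0 er edr re rr.
apply: (bound _ _ _ _ _ _).2 => {bound}.
- by move=> i _; exact: reg.
- by move=> i _; exact: prj.
- by move=> i im; apply: near_l; [exact: leq_addl|case/andP: (win i im)].
- by move=> i im; apply: near_C; [exact: leq_addl|case/andP: (win _ im)].
- move=> i _; apply: proj_step_le (prj _) (near_l _ _ (leqnSn _) (lts _)) _.
  exact: near_C.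
move=> i im zi.
have close j : (j <= n - m)%N -> `|tt m - tt (j + m)%N| <= tau.
  move=> /win/andP[ge0 le_th]; rewrite distrC ger0_norm//.
  exact: le_trans le_th th_tau.
have normal j : prox_normal (C (tt (j + m).+1)) (p (j + m).+1)
    (reaction p (l \o nu) (j + m)).
  exact: proj_set_normal (prj (j + m)%N).
(* A nonzero reaction puts [p (i + m).+1] on the boundary, hence in some ball of the covering;
   iterates within [r] of it lie in the ball of twice the radius, where the same [u q] serves. *)
have [q Jq xq] := (cover _ (ttT _) (close _ im)).1 _
  (prox_normal_boundary (Cp _) (normal i) zi).
exists (u q); first by rewrite u1.
move=> j jm pij zj.
apply: (cover _ (ttT _) (close _ jm)).2 => //.
- exact: prox_normal_boundary (Cp _) (normal j) zj.
- move: xq pij; rewrite /eball/= => xq pij.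
  by have := enormD3 (p (j + m).+1) (p (i + m).+1) (xp q); move: pij; rewrite !addSn; lra.
- exact: normal.
Qed.

End TotalVariation.

(** * Gronwall's lemma and one-step comparison with the solution *)

Section Comparison.
Context {R : realType} {d : nat}.

(** Each step multiplies [E j + kappa] by at most [1 + c j <= expR (c j)]. *)
Lemma discrete_gronwall (E c : nat -> R) (kappa : R) :
  0 <= kappa -> (forall j, 0 <= E j) -> (forall j, 0 <= c j) ->
  (forall j, E j.+1 <= E j + c j * (E j + kappa)) ->
  forall n, E n <= (E 0%N + kappa) * expR (\sum_(0 <= j < n) c j).
Proof.
move=> k0 E0 c0 step n.
suff: E n + kappa <= (E 0%N + kappa) * expR (\sum_(0 <= j < n) c j) by lra.
elim: n => [|n IH]; first by rewrite big_geq// expR0 mulr1.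
rewrite big_nat_recr//= expRD mulrA.
apply: (@le_trans _ _ ((E n + kappa) * (1 + c n))); first by have := step n; lra.
by apply: ler_pM => //; rewrite ?addr_ge0// expR_ge1Dx.
Qed.

(** With [e0 = x0 - p0] and [e1 = x1 - p1], the squared norm grows by at most
    [2 * edot e1 (e1 - e0)], where [e1 - e0 = z - dk]. Prox-regularity at [p1] bounds the pairing
    with [z], the last hypothesis the one with [dk]. *)
Lemma comparison_step (S : set 'rV[R]_d) (eta eps a : R)
    (p0 p1 x0 x1 z dk : 'rV[R]_d) :
  0 < eta -> prox_regular eta S -> S p1 -> S x1 -> prox_normal S p1 z ->
  (x1 - p1) - (x0 - p0) = z - dk ->
  enorm (p1 - p0) <= 3 * eps -> enorm (x1 - x0) <= eps -> 0 <= a ->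
  edot (p1 - x1) dk <=
    ((enorm (x0 - p0) + 6 * eps) ^+ 2 / (2 * eta) + 2 * eps) * a ->
  enorm (x1 - p1) ^+ 2 <= enorm (x0 - p0) ^+ 2 +
    2 / eta * (enorm z + a) *
    (enorm (x0 - p0) ^+ 2 + (36 * eps ^+ 2 + 2 * eta * eps)).
Proof.
move=> eta0 reg Sp Sx nz inc p10 x10 a0 dk_le.
have eps0 : 0 <= eps := le_trans (enorm_ge0 _) x10.
set e0 := x0 - p0 in inc dk_le *; set e1 := x1 - p1 in inc *.
have e1_le : enorm e1 <= enorm e0 + 4 * eps.
  have -> : e1 = e0 + ((x1 - x0) - (p1 - p0)).
    by apply/rowP => j; rewrite !mxE; ring.
  have := enormD e0 (x1 - x0 - (p1 - p0)).
  by have := enormD (x1 - x0) (- (p1 - p0)); rewrite enormN; lra.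
have /= := prox_regular_le eta0 reg Sp Sx nz; rewrite -/e1.
have E0 := enorm_ge0 e0; have E1 := enorm_ge0 e1; have Z0 := enorm_ge0 z.
(* The bound [enorm e0 + 4 * eps] on [enorm e1] is relaxed to [6 * eps] so that both pairings share
   one quadratic term, split by [(a + b)^2 <= 2 (a^2 + b^2)]. *)
have sq6 : (enorm e0 + 6 * eps) ^+ 2 / (2 * eta) <=
    (enorm e0 ^+ 2 + 36 * eps ^+ 2) / eta.
  rewrite ler_pdivrMr ?mulr_gt0//.
  have -> : (enorm e0 ^+ 2 + 36 * eps ^+ 2) / eta * (2 * eta) =
     2 * (enorm e0 ^+ 2 + 36 * eps ^+ 2) by field; rewrite gt_eqF.
  have := sqr_ge0 (enorm e0 - 6 * eps); nra.
have sq4 : enorm e1 ^+ 2 / (2 * eta) <= (enorm e0 + 6 * eps) ^+ 2 / (2 * eta).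
  rewrite ler_wpM2r ?invr_ge0 ?mulr_ge0 ?(ltW eta0)//.
  rewrite ler_pXn2r ?nnegrE//; lra.
set Q := (enorm e0 ^+ 2 + 36 * eps ^+ 2) / eta in sq6.
have -> : 2 / eta * (enorm z + a) *
    (enorm e0 ^+ 2 + (36 * eps ^+ 2 + 2 * eta * eps)) =
    2 * (enorm z + a) * (Q + 2 * eps) by rewrite /Q; field; rewrite gt_eqF.
have zQ : enorm z * enorm e1 ^+ 2 / (2 * eta) <= enorm z * Q.
  by rewrite -mulrA ler_wpM2l// (le_trans sq4).
have aQ : edot (p1 - x1) dk <= (Q + 2 * eps) * a.
  by apply: (le_trans dk_le); rewrite ler_wpM2r// lerD2r.
have zeps : 0 <= enorm z * eps by rewrite mulr_ge0.
have -> : enorm e0 ^+ 2 = enorm e1 ^+ 2 - 2 * edot e1 (z - dk) +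
    enorm (z - dk) ^+ 2.
  by rewrite -sqr_enormB -inc opprB addrC subrK.
have := sqr_ge0 (enorm (z - dk)).
rewrite edotBr (edotC e1 z).
have -> : edot e1 dk = - edot (p1 - x1) dk by rewrite -edotNl opprB.
lra.
Qed.

(** Prox-regularity at [x] compares points of [S], while [p] and [y] may lie outside; replacing them
    by [q] and [x] costs [eps * enorm v] each. *)
Lemma normal_pairing_le (S : set 'rV[R]_d) (eta eps rho : R)
    (p q x y v : 'rV[R]_d) :
  0 < eta -> prox_regular eta S -> S q -> S x -> prox_normal S x v ->
  enorm (q - p) <= eps -> enorm (x - y) <= eps -> enorm (p - y) <= rho ->
  edot (p - y) v <= ((rho + 2 * eps) ^+ 2 / (2 * eta) + 2 * eps) * enorm v.
Proof.
move=> eta0 reg Sq Sx nv qp xy py.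
have := prox_regular_le eta0 reg Sx Sq nv.
have V0 := enorm_ge0 v.
have qx : enorm (q - x) <= rho + 2 * eps.
  have := enormD3 q p x; have := enormD3 p y x; rewrite (enormB y); lra.
have sq : enorm v * enorm (q - x) ^+ 2 / (2 * eta) <=
    enorm v * ((rho + 2 * eps) ^+ 2 / (2 * eta)).
  rewrite mulrA ler_wpM2r ?invr_ge0 ?mulr_ge0 ?(ltW eta0)// ler_wpM2l//.
  by rewrite ler_pXn2r ?nnegrE ?enorm_ge0// (le_trans (enorm_ge0 _) qx).
have -> : p - y = (q - x) + (p - q) + (x - y).
  by apply/rowP => j; rewrite !mxE; ring.
rewrite (edotDl (q - x + (p - q))) (edotDl (q - x)) (edotC (q - x)).
have : edot (p - q) v <= eps * enorm v.
  by apply: (le_trans (edot_le _ _)); rewrite ler_wpM2r// enormB.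
have : edot (x - y) v <= eps * enorm v.
  by apply: (le_trans (edot_le _ _)); rewrite ler_wpM2r.
lra.
Qed.

End Comparison.

(** * Time nodes and the error of the scheme *)

Section Scheme.
Context {R : realType} {d : nat}.

Lemma node_in_itv (T h : R) n : 0 < T -> 0 < h -> node T h n \in `[0, T].
Proof.
move=> T0 h0; rewrite in_itv/= ge_min lexx orbT andbT le_min (ltW T0) andbT.
by rewrite mulr_ge0// ltW.
Qed.

Lemma node_le (T h : R) m n : 0 < h -> (m <= n)%N -> node T h m <= node T h n.
Proof.
move=> h0 mn; rewrite /node le_min ge_min ler_pM2r// ler_nat mn/=.
by rewrite ge_min lexx orbT.
Qed.

Lemma nodeS_le (T h : R) n : 0 < h -> node T h n.+1 <= node T h n + h.
Proof.
move=> h0; rewrite /node -natr1 mulrDl mul1r.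
have [nT|Tn] := lerP (n%:R * h) T; first by rewrite ge_min lexx.
by rewrite ge_min lerDl (ltW h0) orbT.
Qed.

Lemma nodeS_eq (T h : R) n : 0 < h -> node T h n.+1 <= node T h n ->
  node T h n = T /\ node T h n.+1 = T.
Proof.
move=> h0; rewrite /node -natr1 mulrDl mul1r.
by have [h1|h1] := lerP (n%:R * h) T; have [h2|h2] := lerP (n%:R * h + h) T; lra.
Qed.

Lemma node_cover (T h t : R) : 0 < h -> t \in `[0, T] ->
  t <= node T h 1 \/
  exists2 n, (1 <= n)%N & t \in `]node T h n, node T h n.+1].
Proof.
move=> h0; rewrite in_itv/= => /andP[t0 tT].
have [N tN] : exists N, t <= node T h N.+1.
  exists (Num.truncn (T / h)); rewrite /node le_min tT andbT (le_trans tT)//.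
  by rewrite -ler_pdivrMr// ltW// truncnS_gt.
elim: N tN => [|N IH] tN; first by left.
have [tN'|tN'] := lerP t (node T h N.+1); first exact: IH.
by right; exists N.+1 => //; rewrite in_itv/= tN' tN.
Qed.

(** [e] is the error at the preceding node, controlled by Gronwall; from there to [t] the scheme
    moves by at most [3 * eps] and the solution by [eps]. Before the first node, [e = 0]. *)
Lemma scheme_error (T : R) (C : R -> set 'rV[R]_d) (l x k xi y : R -> 'rV[R]_d)
    (M : R -> R) (u0 : 'rV[R]_d) (eta eps h B th : R) :
  0 < T -> 0 < eta -> 0 < eps -> 0 < h -> 2 * h <= T -> 2 * h <= th ->
  (forall t, t \in `[0, T] -> prox_regular eta (C t)) ->
  C 0 u0 -> x 0 = u0 ->
  (forall t, t \in `[0, T] -> C t (x t)) ->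
  (forall t, t \in `[0, T] -> x t + k t = l t) ->
  (forall s, s \in `[0, T] -> prox_normal (C s) (x s) (xi s)) ->
  (forall s t (w : 'rV[R]_d) c, 0 <= s -> s <= t -> t <= T -> 0 <= c ->
      (forall r, r \in `]s, t] -> edot w (xi r) <= c * enorm (xi r)) ->
      edot w (k t - k s) <= c * (M t - M s)) ->
  (forall s t, s \in `[0, T] -> t \in `[0, T] -> `|t - s| <= 2 * h ->
     forall p, C s p -> exists2 q, C t q & enorm (q - p) <= eps) ->
  (forall s t, s \in `[0, T] -> t \in `[0, T] -> `|t - s| <= 2 * h ->
     enorm (l t - l s) <= eps) ->
  (forall s t, s \in `[0, T] -> t \in `[0, T] -> `|t - s| <= 2 * h ->
     enorm (x t - x s) <= eps) ->
  (forall (tt nu : nat -> R) (p : nat -> 'rV[R]_d),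
      (forall j, tt j \in `[0, T]) -> (forall j, nu j \in `[0, T]) ->
      (forall j, tt j <= tt j.+1 <= tt j + th) ->
      (forall i j, (i <= j)%N -> `|nu j - nu i| <= tt j - tt i) ->
      (forall j, C (tt j) (p j)) ->
      (forall j, proj_set (C (tt j.+1)) (p j + (l (nu j.+1) - l (nu j))) (p j.+1)) ->
      forall n, \sum_(0 <= j < n) enorm (reaction p (l \o nu) j) <= B) ->
  discretized T C l u0 h y ->
  forall t, t \in `[0, T] -> exists2 e : R, enorm (x t - y t) <= e + 4 * eps &
    0 <= e /\ e ^+ 2 <= (37 * eps ^+ 2 + 2 * eta * eps) *
                      expR (2 / eta * (B + (M T - M 0))).
Proof.
move=> T0 eta0 eps0 h0 hT hth reg C0 x0 Cx xkl nxi dM nearC modl modx tvB [y1 yS].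
(* The scheme is constant up to the first node, so the iteration starts there and [nu] is shifted by
   one. Since [u0] is known to lie in [C 0] only, the first set is dated 0, and the first step of
   [tt] may be as long as [2 * h]. *)
pose nu j := node T h j.+1.
pose tt j := if j is 0%N then 0 else nu j.
pose p j := y (nu j).
have nuT j : nu j \in `[0, T] by exact: node_in_itv.
have nu0T j : 0 <= nu j <= T by have := nuT j; rewrite in_itv.
have zT : 0 \in `[0, T] by rewrite in_itv/= lexx ltW.
have ttT j : tt j \in `[0, T] by rewrite /tt; case: j => [|j].
have nu_le i j : (i <= j)%N -> nu i <= nu j by move=> ij; apply: node_le.
have nuS j : nu j.+1 <= nu j + h by exact: nodeS_le.
have nu0 : nu 0%N = h by rewrite /nu /node mul1r min_l//; lra.
have ttS j : tt j <= tt j.+1 <= tt j + 2 * h.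
  case: j => [|j] /=; first by case/andP: (nu0T 1%N) => -> _; have := nuS 0%N; lra.
  by rewrite nu_le//=; have := nuS j.+1; lra.
have nutt i j : (i <= j)%N -> `|nu j - nu i| <= tt j - tt i.
  move=> ij; rewrite ger0_norm ?subr_ge0 ?nu_le//.
  case: i ij => [|i]; case: j => [|j] //= _; first by rewrite !subrr.
  by rewrite lerD2l lerN2; case/andP: (nu0T 0%N).
have p0 : p 0%N = u0.
  by apply: y1; rewrite in_itv/= lexx andbT; case/andP: (nu0T 0%N).
have Cproj j : C (tt j) (p j) /\
    proj_set (C (tt j.+1)) (p j + (l (nu j.+1) - l (nu j))) (p j.+1).
  elim: j => [|j [_ IH]].
    split; first by rewrite p0.
    rewrite addrA; apply: yS => //; rewrite in_itv/= lexx andbT ltNge.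
    by apply/negP => /(nodeS_eq h0)[]; rewrite -/(nu 0%N) nu0; lra.
  have Cp : C (tt j.+1) (p j.+1) by case: IH.
  split=> //; rewrite addrA.
  (* Once the node [T] is reached, all later steps are degenerate: a point of [C T] is its own
     projection. *)
  have [e|lt] := lerP (nu j.+2) (nu j.+1); last first.
    by apply: yS => //; rewrite in_itv/= lexx andbT.
  have [E1 E2] := nodeS_eq h0 e.
  have {}E2 : nu j.+2 = nu j.+1 by rewrite /nu E1 E2.
  rewrite -addrA /p /= E2 subrr addr0; split; first exact: Cp.
  by rewrite subrr enorm0 edist_set_self//; exact: Cp.
have Cp j : C (tt j) (p j) := (Cproj j).1.
have prj j := (Cproj j).2.
have variation := tvB tt nu p ttT nuT.
have {variation} variation n :
    \sum_(0 <= j < n) enorm (reaction p (l \o nu) j) <= B.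
  apply: variation => // j; case/andP: (ttS j) => -> /=; lra.
have close s t : s <= t -> t <= s + 2 * h -> `|t - s| <= 2 * h.
  by move=> st ts; rewrite ger0_norm ?subr_ge0//; lra.
have nuSS j : nu j.+1 <= nu j + 2 * h by have := nuS j; lra.
have near j : exists2 q, C (tt j.+1) q & enorm (q - p j) <= eps.
  by apply: (nearC (tt j)) => //; case/andP: (ttS j) => ? ?; exact: close.
have lstep j t : t \in `]nu j, nu j.+1] -> enorm (l t - l (nu j)) <= eps.
  rewrite in_itv/= => /andP[jt tj]; apply: modl => //.
    rewrite in_itv/=; have := nu0T j; have := nu0T j.+1; lra.
  by apply: close; [exact: ltW|have := nuSS j; lra].
have pstep j : enorm (p j.+1 - p j) <= 3 * eps.
  apply: proj_step_le (prj j) _ (near j).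
  by apply: modl => //; apply: close => //; exact: nu_le.
have xstep j : enorm (x (nu j.+1) - x (nu j)) <= eps.
  by apply: modx => //; apply: close => //; exact: nu_le.
have dM_ge0 s t : 0 <= s -> s <= t -> t <= T -> 0 <= M t - M s.
  move=> s0 st tT; have := dM s t 0 1 s0 st tT ler01; rewrite edot0l mul1r; apply.
  by move=> r _; rewrite edot0l mul1r enorm_ge0.
pose E j := enorm (x (nu j) - p j) ^+ 2.
pose c j := 2 / eta * (enorm (reaction p (l \o nu) j) + (M (nu j.+1) - M (nu j))).
pose kappa := 36 * eps ^+ 2 + 2 * eta * eps.
have dMj j : 0 <= M (nu j.+1) - M (nu j).
  have := nu0T j; have := nu0T j.+1 => /andP[? ?] /andP[? ?].
  by apply: dM_ge0; rewrite // nu_le.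
have c0 j : 0 <= c j.
  apply: mulr_ge0; first by rewrite divr_ge0// ltW.
  by rewrite addr_ge0// enorm_ge0.
have kappa0 : 0 <= kappa.
  by apply: addr_ge0; rewrite !mulr_ge0 ?sqr_ge0 ?(ltW eta0) ?(ltW eps0)//.
have step j : E j.+1 <= E j + c j * (E j + kappa).
  have := nu0T j; have := nu0T j.+1 => /andP[nS0 nST] /andP[n0 nT].
  apply: (comparison_step (S := C (nu j.+1))
    (dk := k (nu j.+1) - k (nu j))) => //; rewrite ?nu_le//.
  - exact: reg.
  - exact: Cp j.+1.
  - exact: Cx.
  - exact: proj_set_normal (prj j).
  - have -> : x (nu j.+1) = l (nu j.+1) - k (nu j.+1) by rewrite -xkl ?addrK.
    have -> : x (nu j) = l (nu j) - k (nu j) by rewrite -xkl ?addrK.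
    by rewrite /reaction/=; apply/rowP => i; rewrite !mxE; ring.
  (* At each time [r] of the step the pairing is bounded in [C r], through a point [q] of [C r] near
     [p j.+1]. The points [p j.+1] and [x (nu j.+1)] are at most [enorm (x (nu j) - p j) + 4 * eps]
     apart; passing to [q] and [x r] turns 4 into 6. *)
  apply: dM; rewrite ?nu_le//.
    by rewrite addr_ge0 ?divr_ge0 ?sqr_ge0 ?mulr_ge0 ?(ltW eta0) ?(ltW eps0)//.
  move=> r /andP[]; rewrite !bnd_simp => jr rj.
  have rT : r \in `[0, T].
    by rewrite in_itv/= (le_trans n0 (ltW jr)) (le_trans rj nST).
  have rnu : `|nu j.+1 - r| <= 2 * h by apply: close => //; have := nuSS j; lra.
  have [q Cq qp] : exists2 q, C r q & enorm (q - p j.+1) <= eps.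
    by apply: (nearC (nu j.+1)) (Cp j.+1) => //; rewrite distrC.
  have xr : enorm (x r - x (nu j.+1)) <= eps by apply: modx; rewrite // distrC.
  have := @normal_pairing_le _ _ (C r) eta eps (enorm (x (nu j) - p j) + 4 * eps)
    (p j.+1) q (x r) (x (nu j.+1)) (xi r) eta0 (reg r rT) Cq (Cx r rT) (nxi r rT) qp xr.
  have -> : enorm (x (nu j) - p j) + 4 * eps + 2 * eps =
    enorm (x (nu j) - p j) + 6 * eps by ring.
  apply.
  have := enormD3 (p j.+1) (p j) (x (nu j.+1)).
  have := enormD3 (p j) (x (nu j)) (x (nu j.+1)).
  rewrite (enormB (p j) (x (nu j))) (enormB (x (nu j)) (x (nu j.+1))).
  by have := pstep j; have := xstep j; lra.
have E00 : E 0%N <= eps ^+ 2.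
  rewrite /E p0 -x0 ler_pXn2r ?nnegrE ?enorm_ge0 ?(ltW eps0)//.
  by apply: modx => //; apply: close; rewrite nu0; lra.
have c_sum n : \sum_(0 <= j < n) c j <= 2 / eta * (B + (M T - M 0)).
  rewrite -mulr_sumr ler_wpM2l ?divr_ge0 ?(ltW eta0)//.
  rewrite big_split/= lerD// telescope_sumr//.
  have := dM_ge0 0 (nu 0%N); have := dM_ge0 (nu n) T.
  have := nu0T n; have := nu0T 0%N => /andP[a1 a2] /andP[a3 a4].
  by move=> /(_ a3 a4 (lexx _)) ? /(_ (lexx _) a1 a2) ?; lra.
(* 37 is the 36 of [kappa] plus 1 for the initial error [E 0 <= eps ^+ 2]. *)
have Ebound n : E n <= (37 * eps ^+ 2 + 2 * eta * eps) *
    expR (2 / eta * (B + (M T - M 0))).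
  have E_ge0 j : 0 <= E j by exact: sqr_ge0.
  apply: (le_trans (discrete_gronwall kappa0 E_ge0 c0 step n)).
  apply: ler_pM; [exact: addr_ge0|exact: expR_ge0| |by rewrite ler_expR].
  by rewrite /kappa; lra.
move=> t tT; have [t1|[[//|j] _ tj]] := node_cover h0 tT.
  exists 0; last first.
    split=> //; rewrite expr0n/= mulr_ge0 ?expR_ge0//.
    by rewrite addr_ge0 ?mulr_ge0 ?sqr_ge0 ?(ltW eta0) ?(ltW eps0)//.
  have t0 : 0 <= t by move: tT; rewrite in_itv/= => /andP[].
  rewrite y1 ?in_itv/= ?t0// -x0 add0r.
  apply: (@le_trans _ _ eps); last by lra.
  by apply: modx => //; apply: close => //; move: t1; rewrite -/(nu 0%N) nu0; lra.
exists (enorm (x (nu j) - p j)); last by split; [exact: enorm_ge0|exact: Ebound].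
have yp : enorm (y t - p j) <= 3 * eps.
  apply: proj_step_le (lstep j t tj) (near j).
  by rewrite addrA; exact: yS.
have xt : enorm (x t - x (nu j)) <= eps.
  apply: modx => //; move: tj; rewrite in_itv/= => /andP[jt tj].
  by apply: close; [exact: ltW|have := nuSS j; rewrite /nu in jt tj *; lra].
have := enormD3 (x t) (x (nu j)) (y t); have := enormD3 (x (nu j)) (p j) (y t).
by rewrite (enormB (p j)); lra.
Qed.

End Scheme.

(** * Convergence in the essential supremum norm *)

Lemma Linfty_dist_le (R : realType) (d : nat) (T : R) (x y : R -> 'rV[R]_d) (e : R) :
  0 <= e -> (forall t, t \in `[0, T] -> enorm (x t - y t) <= e) ->
  (0 <= Linfty_dist T x y <= e%:E)%E.
Proof.
move=> e0 xy; rewrite Lnorm_ge0/= /Linfty_dist unlock; case: ifPn => // _.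
apply/ess_supP; apply: nearW => t /=; rewrite patchE; case: ifPn => tT.
  rewrite lee_fin ger0_norm ?enorm_ge0//; apply: xy.
  by move: tT; rewrite inE.
by rewrite abse0 lee_fin.
Qed.

Theorem theorem4p2 (R : realType) (d : nat) (T : R) (C : R -> set 'rV[R]_d)
    (l : R -> 'rV[R]_d) (u0 : 'rV[R]_d) :
  0 < T ->
  (forall t : R, t \in `[0, T] -> closed (C t) /\ C t !=set0) ->
  admissible T C ->
  abs_continuously_varying T C ->
  {within `[0, T], continuous l} ->
  l 0 = u0 -> C 0 u0 ->
  forall x k : R -> 'rV[R]_d,
  skorohod_solution T C l x k ->
  forall xt : R -> R -> 'rV[R]_d,
  (forall h : R, 0 < h -> discretized T C l u0 h (xt h)) ->
  Linfty_dist T (xt h) x @[h --> 0^'+] --> 0%E.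
Proof.
move=> T0 clC adm ac cl l0 C0 x k sol xt disc.
have Cne t : t \in `[0, T] -> C t !=set0 by move=> /clC[].
have [k0 [xi [M [nxi dM]]]] := skorohod_density T0 sol.
have [B [th [th0 B0 tvB]]] := catching_up_variation T0 Cne adm ac cl.
have [[eta eta0 reg] _] := adm.
have [cx _ Cx _ xkl] := sol.
have x0 : x 0 = u0.
  by rewrite -l0 -xkl ?k0 ?addr0// in_itv/= lexx ltW.
pose G := expR (2 / eta * (B + (M T - M 0))).
have G0 : 0 < G := expR_gt0 _.
have uniform (e : R) : 0 < e -> \forall h \near 0^'+,
    forall t, t \in `[0, T] -> enorm (xt h t - x t) <= e.
  move=> e0.
  (* As [eps <= 1], [37 * eps ^+ 2 + 2 * eta * eps] is at most [(37 + 2 * eta) * eps], so the third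
     bound gives [e1 <= e / 2]; the second gives [4 * eps <= e / 2]. *)
  pose eps := Num.min 1 (Num.min (e / 8) ((e / 2) ^+ 2 / ((37 + 2 * eta) * G))).
  have G1 : 0 < (37 + 2 * eta) * G by rewrite mulr_gt0// addr_gt0// mulr_gt0.
  have eps0 : 0 < eps by rewrite !lt_min ltr01 !divr_gt0// exprn_gt0// divr_gt0.
  have [eps1 epse epsG] : [/\ eps <= 1, eps <= e / 8 &
      eps <= (e / 2) ^+ 2 / ((37 + 2 * eta) * G)].
    by rewrite !ge_min !lexx !orbT.
  have [th1 th10 H1] := varying_near Cne ac eps0.
  have [th2 th20 H2] := unif_continuous_itv cl eps0.
  have [th3 th30 H3] := unif_continuous_itv cx eps0.
  (* Halved because the moduli are taken over times up to [2 * h]. *)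
  pose hmax := Num.min (Num.min T th) (Num.min th1 (Num.min th2 th3)) / 2.
  have hmax0 : 0 < hmax by rewrite divr_gt0// !lt_min T0 th0 th10 th20.
  near=> h.
  have h0 : 0 < h by [].
  have : h <= hmax by near: h; exact: nbhs_right_le.
  rewrite /hmax ler_pdivlMr// mulrC !le_min.
  move=> /andP[/andP[hT hth] /and3P[h1 h2 h3]] t tT.
  have [|||e1 xy [e10 e1G]] := scheme_error T0 eta0 eps0 h0 hT hth reg C0 x0 Cx
    xkl nxi dM _ _ _ tvB (disc h h0) tT.
  - by move=> s r sT rT rs; apply: H1 => //; exact: le_trans h1.
  - by move=> s r sT rT rs; apply: H2 => //; exact: le_trans h2.
  - by move=> s r sT rT rs; apply: H3 => //; exact: le_trans h3.
  have : e1 <= e / 2.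
    rewrite -(@ler_pXn2r _ 2) ?nnegrE ?divr_ge0 ?(ltW e0)//.
    apply: (le_trans e1G); move: epsG; rewrite ler_pdivlMr// mulrA.
    apply: le_trans; rewrite -/G ler_pM2r//; nra.
  by rewrite enormB; lra.
have bounds (e : R) : 0 < e -> \forall h \near 0^'+,
    (0 <= Linfty_dist T (xt h) x <= e%:E)%E.
  move=> e0; near=> h; apply: Linfty_dist_le; first exact: ltW.
  by near: h; exact: uniform.
apply/fine_cvgP; split.
  near=> h; have /andP[d0 d1] : (0 <= Linfty_dist T (xt h) x <= 1%:E)%E.
    by near: h; exact: bounds.
  by rewrite ge0_fin_numE// (le_lt_trans d1)// ltry.
apply/cvgrPdist_le => e e0; near=> h.
have /andP[d0 d1] : (0 <= Linfty_dist T (xt h) x <= e%:E)%E.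
  by near: h; exact: bounds.
rewrite /= sub0r normrN ger0_norm ?fine_ge0//.
by rewrite -lee_fin fineK// ge0_fin_numE// (le_lt_trans d1)// ltry.
Unshelve. all: by end_near. Qed.
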